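(* Let $k$ be a field, $n\ge1$ an integer, $q=(q_{ij})$ a multiplicatively antisymmetric $n\times n$ matrix over $k^\times$, and $L=k_q[[x_1^{\pm1},\ldots,x_n^{\pm1}]]$ the $q$-commutative Laurent series ring. Then the center $Z$ of $L$ is a noetherian domain.
   Context: Multiplicatively antisymmetric means $q_{ii}=1$ and $q_{ij}=q_{ji}^{-1}\in k^\times$ for all $i,j$. Let $R=k_q[[x_1,\ldots,x_n]]$ be the associative unital $k$-algebra of formal skew power series $\sum_{s\in\mathbb{N}^n} c_s x^s$ ($c_s\in k$, $x^s=x_1^{s_1}\cdots x_n^{s_n}$, $\mathbb{N}$ the non-negative integers), with multiplication determined by $x_ix_j=q_{ij}x_jx_i$. It is a noetherian domain and each $x_i$ is normal. The ring $L$ is the Ore localization of $R$ at the multiplicatively closed set generated by $1,x_1,\ldots,x_n$; its elements are the series $\sum_{s\in\mathbb{Z}^n}c_sx^s$, $c_s\in k$, with $c_s=0$ for $\min\{s_1,\ldots,s_n\}\ll0$. *)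

(* Defs.v *)
From HB Require Import structures.
From mathcomp Require Import all_boot all_order all_algebra.
From mathcomp Require Import boolp classical_sets functions cardinality fsbigop.
From mathcomp Require Import zify ring.

Set Implicit Arguments.
Unset Strict Implicit.
Unset Printing Implicit Defensive.

Import Order.TTheory GRing.Theory Num.Theory.
Local Open Scope classical_set_scope.
Local Open Scope ring_scope.

Definition mult_antisym (k : fieldType) (n : nat) (q : 'M[k]_n) : Prop :=
  (forall i, q i i = 1) /\
  (forall i j, q i j != 0 /\ q i j = (q j i)^-1).

Section QLaurent.
Variables (k : fieldType) (n : nat) (q : 'M[k]_n).
Local Notation expo := 'rV[int]_n.

(* The scalar such that x^s x^t = qtwist s t x^(s+t), where
   x^s = x_1^(s_1) ... x_n^(s_n): each x_i standing in x^s is moved to the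
   right of each x_j, j < i, standing in x^t, by x_i x_j = q_ij x_j x_i. *)
Definition qtwist (s t : expo) : k :=
  \prod_(i < n) \prod_(j < n | (j < i)%N) q i j ^ (s 0 i * t 0 j).

Definition bounded_below (c : expo -> k) : Prop :=
  exists N : int, forall s : expo, (exists i, s 0 i < N) -> c s = 0.

Definition bounded_below_pred : {pred expo -> k} :=
  fun c => `[< bounded_below c >].

Lemma bounded_belowP (c : expo -> k) :
  reflect (exists N : nat, forall s : expo, c s != 0 -> forall i, - N%:Z <= s 0 i)
          (c \in bounded_below_pred).
Proof.
apply: (iffP (asboolP (bounded_below c))) => -[N HN].
  exists `|N|%N => s cs0 i; rewrite leNgt; apply/negP => lt_s.
  move/eqP: cs0; apply; apply: HN; exists i; lia.
exists (- N%:Z) => s [i si]; apply/eqP; apply/negPn/negP => /HN/(_ i).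
by rewrite leNgt si.
Qed.

Lemma bounded_below_zmod_closed : zmod_closed bounded_below_pred.
Proof.
split; first by apply/bounded_belowP; exists 0%N => s; rewrite eqxx.
move=> f g /bounded_belowP[N HN] /bounded_belowP[M HM].
apply/bounded_belowP; exists (N + M)%N => s Hs i.
have [fs0|/HN/(_ i)] := eqVneq (f s) 0; last by lia.
have [gs0|/HM/(_ i)] := eqVneq (g s) 0; last by lia.
case/eqP: Hs.
by rewrite -[LHS]/(f s - g s) fs0 gs0 subr0.
Qed.

HB.instance Definition _ :=
  GRing.isZmodClosed.Build (expo -> k) bounded_below_pred
    bounded_below_zmod_closed.

(* The hypothesis on q is a (phantom) parameter of the type, since the product
   defined below is associative only because of it. *)
Record qlaurent (hq : mult_antisym q) : Type :=
  QLaurent { coef :> expo -> k ; _ : coef \in bounded_below_pred }.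

Variable hq : mult_antisym q.
Local Notation L := (qlaurent hq).

HB.instance Definition _ := [isSub of L for @coef hq].
HB.instance Definition _ := [Choice of L by <:].
HB.instance Definition _ := [SubChoice_isSubZmodule of L by <:].

Implicit Types (f g h : L) (s t u : expo).

Lemma coefP f g : (forall s, f s = g s) -> f = g.
Proof. by move=> fg; apply/val_inj/funext. Qed.

Lemma coefD f g s : (f + g) s = f s + g s. Proof. by []. Qed.

Lemma qscale_bounded (a : k) f :
  (fun s => a * f s) \in bounded_below_pred.
Proof.
have /bounded_belowP[N HN] := valP f; apply/bounded_belowP; exists N => s.
by rewrite mulf_eq0 negb_or => /andP[_ /HN].
Qed.

Definition qscale (a : k) f : L := QLaurent hq (qscale_bounded a f).

Lemma qscaleA (a b : k) f : qscale a (qscale b f) = qscale (a * b) f.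
Proof. by apply: coefP => s /=; rewrite mulrA. Qed.
Lemma qscale1 : left_id 1 qscale.
Proof. by move=> f; apply: coefP => s /=; rewrite mul1r. Qed.
Lemma qscaleDr : right_distributive qscale +%R.
Proof. by move=> a f g; apply: coefP => s; exact: mulrDr. Qed.
Lemma qscaleDl f : {morph qscale^~ f : a b / a + b}.
Proof. by move=> a b; apply: coefP => s; exact: mulrDl. Qed.

HB.instance Definition _ :=
  GRing.Zmodule_isLmodule.Build k L qscaleA qscale1 qscaleDr qscaleDl.

Lemma coefZ (a : k) f s : (a *: f) s = a * f s. Proof. by []. Qed.

Lemma coef_bounded f :
  exists N : nat, forall s, f s != 0 -> forall i, - N%:Z <= s 0 i.
Proof. exact/bounded_belowP/(valP f). Qed.

Lemma qtwist0l t : qtwist 0 t = 1.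
Proof.
by rewrite /qtwist big1 // => i _; rewrite big1 // => j _; rewrite mxE mul0r expr0z.
Qed.

Lemma qtwist0r s : qtwist s 0 = 1.
Proof.
by rewrite /qtwist big1 // => i _; rewrite big1 // => j _; rewrite mxE mulr0 expr0z.
Qed.

Lemma qtwistDl s t u : qtwist (s + t) u = qtwist s u * qtwist t u.
Proof.
rewrite /qtwist -big_split; apply: eq_bigr => i _ /=.
rewrite -big_split; apply: eq_bigr => j _ /=.
by rewrite mxE mulrDl expfzDr //; case: (hq.2 i j).
Qed.

Lemma qtwistDr s t u : qtwist s (t + u) = qtwist s t * qtwist s u.
Proof.
rewrite /qtwist -big_split; apply: eq_bigr => i _ /=.
rewrite -big_split; apply: eq_bigr => j _ /=.
by rewrite mxE mulrDr expfzDr //; case: (hq.2 i j).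
Qed.

Definition box (K : nat) : set expo := [set t : expo | forall i, (`|t 0%R i| <= K)%N].

Lemma finite_box K : finite_set (box K).
Proof.
pose F (e : 'rV['I_(K.*2.+1)]_n) : expo := \row_i ((e 0 i : nat)%:Z - K%:Z).
apply: (@sub_finite_set _ _ (F @` setT)); last exact/finite_image/finite_finset.
move=> t tK; exists (\row_i inord (absz (t 0 i + K%:Z))) => //.
apply/rowP => i; rewrite !mxE inordK; have := tK i; lia.
Qed.

Lemma fsum_box (F : expo -> k) K : (forall t, F t != 0 -> box K t) ->
  \sum_(t \in [set: expo]) F t = \sum_(t \in box K) F t.
Proof.
move=> FK; apply/esym/fsbig_widen => // t [_ /= tK].
by apply/eqP/negPn/negP => /FK.
Qed.

Lemma fsum_single (F : expo -> k) a : (forall t, t != a -> F t = 0) ->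
  \sum_(t \in [set: expo]) F t = F a.
Proof.
move=> F0; rewrite -(fsbig_widen [set a]) ?fsbig_set1 //.
by move=> t [_ /= /eqP/F0].
Qed.

Definition expo_size s : nat := \max_(i < n) `|s 0%R i|%N.

Lemma le_expo_size s i : (`|s 0%R i| <= expo_size s)%N.
Proof. exact: (leq_bigmax (F := fun i => `|s 0%R i|%N)). Qed.

Let expoB s t i : (s - t) 0 i = (s 0 i : int) - (t 0 i : int).
Proof. by rewrite !mxE. Qed.

Lemma conv_box f g s :
  exists K, forall t, f t * g (s - t) != 0 -> box K t.
Proof.
have [N HN] := coef_bounded f; have [M HM] := coef_bounded g.
exists (N + M + expo_size s)%N => t; rewrite mulf_eq0 negb_or => /andP[/HN fN /HM gM] i.
have := fN i; have := gM i; have := le_expo_size s i; rewrite ?expoB; lia.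
Qed.

(* All but finitely many terms of this sum vanish, by [conv_box]. *)
Definition qmul_coef f g s : k :=
  \sum_(t \in [set: expo]) f t * g (s - t) * qtwist t (s - t).

Lemma qmul_bounded f g : qmul_coef f g \in bounded_below_pred.
Proof.
have [N HN] := coef_bounded f; have [M HM] := coef_bounded g.
apply/bounded_belowP; exists (N + M)%N => s Hs i; rewrite leNgt; apply/negP => si.
case/eqP: Hs; apply: fsbig1 => t _.
have [->|/HN/(_ i) ft] := eqVneq (f t) 0; first by rewrite !mul0r.
have [->|/HM/(_ i)] := eqVneq (g (s - t)) 0; first by rewrite mulr0 mul0r.
rewrite ?expoB; lia.
Qed.

Definition qmul f g : L := QLaurent hq (qmul_bounded f g).

Lemma qmono_bounded s : (fun t => (t == s)%:R) \in bounded_below_pred.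
Proof.
apply/bounded_belowP; exists (expo_size s) => t; have [-> _|_] := eqVneq t s.
  by move=> i; have := le_expo_size s i; lia.
by rewrite eqxx.
Qed.

Definition qmono s : L := QLaurent hq (qmono_bounded s).

Lemma qmulDl : left_distributive qmul +%R.
Proof.
move=> f g h; apply: coefP => s; rewrite coefD /= /qmul_coef.
have [K HK] := conv_box f h s; have [M HM] := conv_box g h s.
have H (F : L) P : (forall t, F t * h (s - t) != 0 -> box P t) ->
    (P <= K + M)%N ->
    \sum_(t \in [set: expo]) F t * h (s - t) * qtwist t (s - t) =
    \sum_(t \in box (K + M)) F t * h (s - t) * qtwist t (s - t).
  move=> HP PKM; apply: fsum_box => t; rewrite mulf_eq0 negb_or.
  by case/andP => /HP tP _ i; apply: leq_trans (tP i) PKM.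
rewrite (H f K) ?leq_addr // (H g M) ?leq_addl // -fsbig_split; last exact: finite_box.
rewrite /= (@fsum_box _ (K + M)).
  by apply: eq_fsbigr => t _; rewrite !mulrDl.
move=> t; rewrite !mulrDl => Ht.
have [f0|/HK tK] := eqVneq (f t * h (s - t)) 0; last by move=> i; have := tK i; lia.
have [g0|/HM tK] := eqVneq (g t * h (s - t)) 0; last by move=> i; have := tK i; lia.
by rewrite f0 g0 !mul0r addr0 eqxx in Ht.
Qed.

Lemma qmulDr : right_distributive qmul +%R.
Proof.
move=> h f g; apply: coefP => s; rewrite coefD /= /qmul_coef.
have [K HK] := conv_box h f s; have [M HM] := conv_box h g s.
have H (F : L) P : (forall t, h t * F (s - t) != 0 -> box P t) ->
    (P <= K + M)%N ->
    \sum_(t \in [set: expo]) h t * F (s - t) * qtwist t (s - t) =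
    \sum_(t \in box (K + M)) h t * F (s - t) * qtwist t (s - t).
  move=> HP PKM; apply: fsum_box => t; rewrite mulf_eq0 negb_or.
  by case/andP => /HP tP _ i; apply: leq_trans (tP i) PKM.
rewrite (H f K) ?leq_addr // (H g M) ?leq_addl // -fsbig_split; last exact: finite_box.
rewrite /= (@fsum_box _ (K + M)).
  by apply: eq_fsbigr => t _; rewrite mulrDr mulrDl.
move=> t; rewrite mulrDr mulrDl => Ht.
have [f0|/HK tK] := eqVneq (h t * f (s - t)) 0; last by move=> i; have := tK i; lia.
have [g0|/HM tK] := eqVneq (h t * g (s - t)) 0; last by move=> i; have := tK i; lia.
by rewrite f0 g0 !mul0r addr0 eqxx in Ht.
Qed.

Lemma qmul1l : left_id (qmono 0) qmul.
Proof.
move=> f; apply: coefP => s; rewrite /= /qmul_coef (@fsum_single _ 0) /=.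
  by rewrite eqxx subr0 qtwist0l mul1r mulr1.
by move=> t /negPf->; rewrite !mul0r.
Qed.

Lemma qmul1r : right_id (qmono 0) qmul.
Proof.
move=> f; apply: coefP => s; rewrite /= /qmul_coef (@fsum_single _ s) /=.
  by rewrite subrr eqxx qtwist0r !mulr1.
move=> t ts; rewrite subr_eq0 eq_sym (negPf ts).
by rewrite mulr0 mul0r.
Qed.

Lemma qmulA : associative qmul.
Proof.
move=> f g h; apply: coefP => s; rewrite /= /qmul_coef.
pose F u t : k :=
  f u * g (t - u) * h (s - t) * (qtwist u (s - u) * qtwist (t - u) (s - t)).
have [K HK] : exists K, forall u t, F u t != 0 -> box K u /\ box K t.
  have [N HN] := coef_bounded f; have [M HM] := coef_bounded g.
  have [P HP] := coef_bounded h.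
  exists (N + M + P + expo_size s)%N => u t.
  rewrite !mulf_eq0 !negb_or => /andP[/andP[/andP[/HN fu /HM gu] /HP hu] _].
  split=> i; move: (fu i) (gu i) (hu i) (le_expo_size s i); rewrite ?expoB; lia.
transitivity (\sum_(u \in [set: expo]) \sum_(t \in [set: expo]) F u t).
  apply: eq_fsbigr => u _; rewrite mulr_fsumr mulr_fsuml.
  rewrite (reindex_fsbigT (fun t => t - u)); last first.
    by exists (fun t => t + u) => t; rewrite (addrK, subrK).
  apply: eq_fsbigr => t _; rewrite /F.
  have -> : s - u - (t - u) = s - t by rewrite opprB addrA subrK.
  ring.
transitivity (\sum_(t \in [set: expo]) \sum_(u \in [set: expo]) F u t).
  have E1 : \sum_(u \in [set: expo]) \sum_(t \in [set: expo]) F u t =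
      \sum_(u \in box K) \sum_(t \in box K) F u t.
    rewrite (@fsum_box _ K); last first.
      by move=> u /fsbigN1[t _ /HK[]].
    by apply: eq_fsbigr => u _; apply: fsum_box => t /HK[].
  have E2 : \sum_(t \in [set: expo]) \sum_(u \in [set: expo]) F u t =
      \sum_(t \in box K) \sum_(u \in box K) F u t.
    rewrite (@fsum_box _ K); last first.
      by move=> t /(@fsbigN1 _ _ _ _ _ _ (fun t u => F u t))[u _ /HK[]].
    by apply: eq_fsbigr => t _; apply: fsum_box => u /HK[].
  by rewrite E1 E2; apply: exchange_fsbig; apply: finite_box.
apply: eq_fsbigr => t _; rewrite !mulr_fsuml.
apply: eq_fsbigr => u _; rewrite /F.
have -> : qtwist t (s - t) = qtwist u (s - t) * qtwist (t - u) (s - t).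
  by rewrite -qtwistDl [u + _]addrC subrK.
have -> : qtwist u (s - u) = qtwist u (t - u) * qtwist u (s - t).
  by rewrite -qtwistDr; congr qtwist; rewrite [RHS]addrC addrA subrK.
ring.
Qed.

Lemma qone_neq0 : qmono 0 != 0.
Proof.
apply/eqP => /(congr1 (fun f : L => f 0)) /eqP.
by rewrite -[X in X == _]/((0 == 0 :> expo)%:R) eqxx -[X in _ == X]/(0 : k) oner_eq0.
Qed.

HB.instance Definition _ := GRing.Zmodule_isNzRing.Build L
  qmulA qmul1l qmul1r qmulDl qmulDr qone_neq0.

Lemma qscaleAl (a : k) f g : a *: (f * g) = (a *: f) * g.
Proof.
apply: coefP => s; rewrite coefZ /= /qmul_coef mulr_fsumr.
by apply: eq_fsbigr => t _; rewrite coefZ !mulrA.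
Qed.

HB.instance Definition _ := GRing.Lmodule_isLalgebra.Build k L qscaleAl.

Lemma qscaleAr (a : k) f g : a *: (f * g) = f * (a *: g).
Proof.
apply: coefP => s; rewrite coefZ /= /qmul_coef mulr_fsumr.
by apply: eq_fsbigr => t _; rewrite coefZ !mulrA [a * f t]mulrC.
Qed.

HB.instance Definition _ := GRing.Lalgebra_isAlgebra.Build k L qscaleAr.

Lemma coefM f g s : (f * g) s =
  \sum_(t \in [set: expo]) f t * g (s - t) * qtwist t (s - t).
Proof. by []. Qed.

Lemma qmonoM s t : qmono s * qmono t = qtwist s t *: qmono (s + t).
Proof.
apply: coefP => u; rewrite coefM coefZ (@fsum_single _ s) /=; last first.
  by move=> v /negPf->; rewrite !mul0r.
rewrite eqxx mul1r subr_eq [t + s]addrC [LHS]mulrC.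
have [->|_] := eqVneq u; first by rewrite [s + t]addrC addrK.
by rewrite !mulr0.
Qed.

(* The next lemmas, down to [qlaurent_frac], identify this algebra with the
   localization of k_q[[x_1, ..., x_n]] at the monoid generated by the x_i. *)
Definition qvar (i : 'I_n) : L := qmono (delta_mx 0 i).

Lemma qtwist_delta i s t (a : int) : s = a *: delta_mx 0 i ->
  qtwist s t = \prod_(j < n | (j < i)%N) q i j ^ (a * t 0 j).
Proof.
move=> ->; rewrite /qtwist (bigD1 i) //= [X in _ * X]big1 ?mulr1 => [|l /negPf li].
  by apply: eq_bigr => j _; rewrite !mxE !eqxx mulr1.
by rewrite big1 // => j _; rewrite !mxE li andbF mulr0 mul0r expr0z.
Qed.

Lemma qtwist_delta2 i j :
  qtwist (delta_mx 0 i) (delta_mx 0 j) = if (j < i)%N then q i j else 1.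
Proof.
rewrite (@qtwist_delta i _ _ 1) ?scale1r //; case: ifP => ji; last first.
  rewrite big1 // => l li; rewrite !mxE mul1r.
  by have [lj|_] := eqVneq l j; rewrite ?expr0z // -lj li in ji *.
rewrite (bigD1 j) //= big1 ?mulr1 => [|l /andP[_ /negPf lj]].
  by rewrite !mxE !eqxx mul1r expr1z.
by rewrite !mxE lj andbF mulr0 expr0z.
Qed.

Lemma qvarC i j : qvar i * qvar j = q i j *: (qvar j * qvar i).
Proof.
rewrite !qmonoM !qtwist_delta2 [delta_mx 0 j + _]addrC scalerA; congr (_ *: _).
have [qii qij] := hq; have [q0 qE] := qij i j.
case: ltngtP => [ij|ij|/val_inj ->]; rewrite ?mulr1 // ?qii //.
by rewrite qE mulVf // (qij j i).1.
Qed.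

Lemma qvar_unit i :
  qvar i * qmono (- delta_mx 0 i) = 1 /\ qmono (- delta_mx 0 i) * qvar i = 1.
Proof.
have tw (s t : expo) : s = delta_mx 0 i \/ s = - delta_mx 0 i ->
    t = delta_mx 0 i \/ t = - delta_mx 0 i -> qtwist s t = 1.
  move=> Hs Ht; have [a ->] : exists a : int, s = a *: delta_mx 0 i.
    by case: Hs => ->; [exists 1; rewrite scale1r | exists (-1); rewrite scaleN1r].
  rewrite (@qtwist_delta i _ _ a) // big1 // => j ji.
  have -> : t 0 j = 0.
    have E : (j == i) = false by apply/negbTE/eqP => ji'; rewrite ji' ltnn in ji.
    by case: Ht => ->; rewrite !mxE E andbF ?oppr0.
  by rewrite mulr0 expr0z.
by split; rewrite qmonoM tw ?(addrN, addNr) ?scale1r; auto.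
Qed.

Lemma qvarX i m : qvar i ^+ m = qmono (m%:Z *: delta_mx 0 i).
Proof.
elim: m => [|m IHm]; first by rewrite scale0r.
rewrite exprS IHm qmonoM (@qtwist_delta i _ _ 1) ?scale1r //.
rewrite big1 => [|j ji]; first by rewrite scale1r intS scalerDl scale1r.
have E : (j == i) = false by apply/negbTE/eqP => ji'; rewrite ji' ltnn in ji.
by rewrite !mxE E andbF !mulr0 expr0z.
Qed.

Lemma qmonoE (s : 'I_n -> nat) :
  qmono (\row_i (s i)%:Z) = \prod_(i < n) qvar i ^+ s i.
Proof.
have H (r : seq 'I_n) : sorted (fun i j : 'I_n => (i < j)%N) r ->
    \prod_(i <- r) qvar i ^+ s i =
    qmono (\sum_(i <- r) (s i)%:Z *: delta_mx 0 i).
  elim: r => [|i r IHr] Hr; first by rewrite !big_nil.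
  rewrite !big_cons IHr ?(path_sorted Hr) // qvarX qmonoM.
  rewrite (@qtwist_delta i _ _ (s i)) // big1 ?scale1r // => j ji.
  rewrite summxE big1_seq ?mulr0 ?expr0z // => l /= lr.
  have il : (i < l)%N.
    have/allP := order_path_min (fun x y z : 'I_n => @ltn_trans x y z) Hr.
    exact.
  have E : (j == l) = false.
    by apply/negbTE/eqP => jl; move: ji; rewrite jl ltnNge (ltnW il).
  by rewrite !mxE E andbF mulr0.
rewrite H; last first.
  have := iota_ltn_sorted 0 n; rewrite -val_enum_ord sorted_map.
  by rewrite [index_enum _]unlock -enumT.
congr qmono; apply/rowP => i; rewrite summxE (bigD1 i) //= big1 ?addr0.
  by rewrite !mxE !eqxx mulr1.
by move=> j /negPf ji; rewrite !mxE eq_sym ji andbF mulr0.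
Qed.

(* The underlying set of k_q[[x_1, ..., x_n]]. *)
Definition qpower_series : set L :=
  [set f | forall s : expo, (exists i, s 0 i < 0) -> f s = 0].

Lemma qpower_series_closed :
  [/\ qpower_series 1,
      forall f g, qpower_series f -> qpower_series g -> qpower_series (f - g) &
      forall f g, qpower_series f -> qpower_series g -> qpower_series (f * g)].
Proof.
split=> [s [i si]|f g Hf Hg s Hs|f g Hf Hg s [i si]].
- rewrite -[LHS]/((s == 0)%:R : k); case: eqP => // s0.
  by rewrite s0 mxE ltxx in si.
- by rewrite -[LHS]/(f s - g s) Hf // Hg // subr0.
- rewrite coefM; apply: fsbig1 => t _; have [ti|ti] := ltP (t 0 i : int) 0.
    by rewrite Hf ?mul0r //; exists i.
  by rewrite Hg ?mulr0 ?mul0r //; exists i; rewrite expoB subr_lt0 (lt_le_trans si ti).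
Qed.

Lemma qlaurent_frac f : exists (N : nat) (r : L),
  qpower_series r /\ f * (\prod_(i < n) qvar i ^+ N) = r.
Proof.
have [N HN] := coef_bounded f; exists N; eexists; split; last by [].
move=> s [i si]; rewrite -qmonoE coefM; apply: fsbig1 => t _.
have [->|/HN/(_ i) ft] := eqVneq (f t) 0; first by rewrite !mul0r.
rewrite /=; case: eqP => [/rowP/(_ i)|_]; last by rewrite mulr0 mul0r.
rewrite expoB mxE; lia.
Qed.

End QLaurent.

Section Center.
Variable A : nzRingType.

Definition ring_center : {pred A} := fun z => `[< forall a, z * a = a * z >].

Lemma ring_center_subring_closed : subring_closed ring_center.
Proof.
split; first by apply/asboolP => a; rewrite mul1r mulr1.
  move=> x y /asboolP Hx /asboolP Hy; apply/asboolP => a.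
  by rewrite mulrBl mulrBr Hx Hy.
move=> x y /asboolP Hx /asboolP Hy; apply/asboolP => a.
by rewrite -mulrA Hy mulrA Hx mulrA.
Qed.

HB.instance Definition _ :=
  GRing.isSubringClosed.Build A ring_center ring_center_subring_closed.

Record center_ring : Type := CenterRing { center_val :> A ; _ : center_val \in ring_center }.

HB.instance Definition _ := [isSub of center_ring for center_val].
HB.instance Definition _ := [Choice of center_ring by <:].
HB.instance Definition _ := [SubChoice_isSubNzRing of center_ring by <:].

Lemma center_mulC : commutative (@GRing.mul center_ring).
Proof. by move=> x y; apply/val_inj; have /asboolP := valP x; apply. Qed.

HB.instance Definition _ := GRing.PzRing_hasCommutativeMul.Build center_ring center_mulC.

End Center.

Section Noetherian.
Variable A : comNzRingType.

Definition is_ideal (I : set A) : Prop :=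
  [/\ I 0, forall x y, I x -> I y -> I (x + y) & forall a x, I x -> I (a * x)].

Definition noetherian : Prop :=
  forall I : nat -> set A,
    (forall m, is_ideal (I m)) -> (forall m, I m `<=` I m.+1) ->
    exists N, forall m, (N <= m)%N -> I m = I N.

(* 1 <> 0 is part of the structure of [A]. *)
Definition noetherian_domain : Prop :=
  GRing.integral_domain_axiom A /\ noetherian.

End Noetherian.

(* Main.v *)
(* A series is central iff its support lies in the subgroup of the exponents s
   such that x^s is central, so restricting supports to this subgroup is a
   Z-linear retraction of L onto its center Z, and every ideal of Z is the
   trace on Z of a right ideal of L. It thus suffices that ascending chains of
   right ideals of L stabilize. The monomials are units of L, so only the power
   series in these ideals matter; by Dickson's lemma finitely many of them have
   lexicographically least exponents dividing all the least exponents that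
   occur, and division by these finitely many series leaves no remainder. The
   coefficients of the quotients solve an infinite triangular system, by
   recursion along the lexicographic order. The center is a domain because the
   least exponent of a product is the sum of the least exponents. *)
Require Import Defs.
From mathcomp Require Import all_boot all_order all_algebra.
From mathcomp Require Import boolp classical_sets functions cardinality fsbigop.
From mathcomp Require Import zify.

Set Implicit Arguments.
Unset Strict Implicit.
Unset Printing Implicit Defensive.

Import Order.TTheory GRing.Theory Num.Theory Defs.
Local Open Scope classical_set_scope.
Local Open Scope ring_scope.

(** * Minima and well-foundedness for the lexicographic order *)

Lemma int_set_min (E : set int) (N : nat) :
  E !=set0 -> (forall a, E a -> - N%:Z <= a) -> exists2 a, E a & forall b, E b -> a <= b.
Proof.
move=> [a Ea] EN; pose P m := `[< E (m%:Z - N%:Z) >].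
have exP : exists m, P m.
  by exists (absz (a + N%:Z)); apply/asboolP; have aN := EN _ Ea; rewrite gez0_abs ?addrK //; lia.
case: (ex_minnP exP) => m /asboolP Em minm; exists (m%:Z - N%:Z) => // b Eb.
have bN := EN _ Eb; have : P (absz (b + N%:Z)).
  by apply/asboolP; rewrite gez0_abs ?addrK //; lia.
move/minm; lia.
Qed.

Section Lex.
Variable n : nat.
Implicit Types s t u : 'rV[int]_n.

Definition lexlt s t : Prop :=
  exists i, s 0 i < t 0 i /\ forall j : 'I_n, (j < i)%N -> s 0 j = t 0 j.

Lemma lexlt_irr s : ~ lexlt s s.
Proof. by case=> i []; rewrite ltxx. Qed.

Lemma lexlt_asym s t : lexlt s t -> ~ lexlt t s.
Proof.
move=> [i [si Hi]] [j [tj Hj]].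
case: (ltngtP i j) => [/Hj ts|/Hi st|/val_inj ij].
- by rewrite ts ltxx in si.
- by rewrite st ltxx in tj.
- by rewrite -ij in tj; have := lt_trans si tj; rewrite ltxx.
Qed.

Lemma lexltD2r u s t : lexlt s t -> lexlt (s + u) (t + u).
Proof.
move=> [i [si Hi]]; exists i; split=> [|j /Hi]; rewrite !mxE; first by rewrite ltrD2r.
by move->.
Qed.

(** The coordinates are minimized one after the other: at stage [d], coordinate [d] is minimized
    among the elements of [E] that share the first [d] coordinates already fixed. *)
Lemma lex_min (E : set 'rV[int]_n) (N : nat) :
  E !=set0 -> (forall s, E s -> forall i, - N%:Z <= s 0 i) ->
  exists2 s, E s & forall t, E t -> t = s \/ lexlt s t.
Proof.
move=> E0 EN.
have H d : (d <= n)%N -> exists2 s, E s & forall t, E t ->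
    (forall j : 'I_n, (j < d)%N -> s 0 j = t 0 j) \/ lexlt s t.
  elim: d => [_|d IHd dn]; first by case: E0 => s Es; exists s => // t _; left.
  have [s Es Hs] := IHd (ltnW dn).
  pose Q := [set t | E t /\ forall j : 'I_n, (j < d)%N -> s 0 j = t 0 j].
  have [||a [t [Et st] <-] Ht] := @int_set_min ((fun t => t 0 (Ordinal dn)) @` Q) N.
  + by exists (s 0 (Ordinal dn)); exists s.
  + by move=> _ [t [Et _] <-]; exact: EN.
  exists t => // u Eu; have [su|[i [si Hi]]] := Hs _ Eu.
    have := Ht (u 0 (Ordinal dn)); have Qu : Q u by [].
    move/(_ (ex_intro2 _ _ u Qu erefl)); rewrite le_eqVlt => /orP[/eqP tu|tu].
      left=> j; rewrite ltnS leq_eqVlt => /orP[/eqP jd|jd].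
        by rewrite (_ : j = Ordinal dn) //; exact: val_inj.
      by rewrite -st ?su.
    right; exists (Ordinal dn); split=> // j jd.
    by rewrite -st ?su.
  have [id|di] := ltnP i d.
    right; exists i; rewrite -st //; split=> // j ji.
    by rewrite -st ?Hi // (ltn_trans ji).
  have : forall j : 'I_n, (j < d)%N -> t 0 j = u 0 j.
    by move=> j jd; rewrite -st // Hi // (leq_trans jd).
  move=> tu; have Qu : Q u by split=> // j jd; rewrite Hi // (leq_trans jd).
  have := Ht (u 0 (Ordinal dn)) (ex_intro2 _ _ u Qu erefl).
  rewrite le_eqVlt => /orP[/eqP tu'|tu']; last by right; exists (Ordinal dn).
  left=> j; rewrite ltnS leq_eqVlt => /orP[/eqP jd|/tu//].
  by rewrite (_ : j = Ordinal dn) //; exact: val_inj.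
have [s Es Hs] := H n (leqnn n).
exists s => // t Et; have [st|] := Hs _ Et; last by right.
  by left; apply/rowP => i; rewrite -st.
Qed.

Definition nonneg s := [forall i, 0 <= s 0 i].

(** Nonnegativity of the smaller exponent is enough: below an inaccessible exponent lies a
    nonnegative inaccessible one, and the least of the latter has none below it. *)
Lemma lex_wf : well_founded (fun s t => nonneg s /\ lexlt s t).
Proof.
move=> s; apply: contrapT => sN.
have H t : ~ Acc (fun s t => nonneg s /\ lexlt s t) t ->
    exists2 u, nonneg u /\ lexlt u t & ~ Acc (fun s t => nonneg s /\ lexlt s t) u.
  move=> tN; apply: contrapT => Ht; apply: tN; constructor => u ut.
  by apply: contrapT => uN; apply: Ht; exists u.
have [t [t0 ts] tN] := H _ sN.
have [||u [u0 uN] Hu] := @lex_min [set u | nonneg u /\ ~ Acc (fun s t => nonneg s /\ lexlt s t) u] 0.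
- by exists t.
- by move=> v [/forallP v0 _] i; rewrite oppr0.
have [v [v0 vu] vN] := H _ uN.
have [vu'|uv] := Hu v (conj v0 vN); first by apply: (@lexlt_irr u); rewrite {1}vu' in vu.
exact: (lexlt_asym uv).
Qed.

End Lex.

(** * Dickson's lemma *)

(** Induction on the number [d] of coordinates compared. Let [F] work for the first [d] coordinates
    and let [M] be its maximum in the next one: [F] still serves every [y] reaching [M] there, and
    each of the finitely many smaller values gets a list of its own. *)
Lemma dickson (n : nat) (T : eqType) (u : T -> 'I_n -> nat) (E : set T) :
  exists F : seq T, (forall x, x \in F -> E x) /\
    forall y, E y -> exists2 x, x \in F & forall i, (u x i <= u y i)%N.
Proof.
suff H d (E' : set T) : (d <= n)%N -> exists F : seq T, (forall x, x \in F -> E' x) /\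
    forall y, E' y -> exists2 x, x \in F & forall i : 'I_n, (i < d)%N -> (u x i <= u y i)%N.
  have [F [FE HF]] := H n E (leqnn n); exists F; split=> // y /HF[x xF xy].
  by exists x => // i; apply: xy.
elim: d E' => [|d IHd] {}E dn.
  have [[x Ex]|E0] := pselect (E !=set0).
    by exists [:: x]; split=> [y|y _]; [rewrite inE => /eqP->|exists x; rewrite ?inE].
  by exists [::]; split=> // y Ey; case: E0; exists y.
pose i := Ordinal dn.
have [F [FE HF]] := IHd E (ltnW dn).
have [G HG] := choice (fun v => IHd [set x | E x /\ u x i = v] (ltnW dn)).
pose M := (\max_(x <- F) u x i)%N.
exists (F ++ flatten [seq G v | v <- iota 0 M]); split=> [x|y Ey].
  rewrite mem_cat => /orP[/FE//|/flatten_mapP[v _ xG]].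
  by case: ((HG v).1 _ xG).
have [yM|My] := ltnP (u y i) M.
  have [x xG xy] := (HG (u y i)).2 y (conj Ey erefl).
  exists x; first by rewrite mem_cat; apply/orP; right; apply/flatten_mapP; exists (u y i); rewrite ?mem_iota.
  move=> j; rewrite ltnS leq_eqVlt => /orP[/eqP jd|/xy//].
  by rewrite (_ : j = i) ?((HG _).1 _ xG).2 //; exact: val_inj.
have [x xF xy] := HF _ Ey; exists x; first by rewrite mem_cat xF.
move=> j; rewrite ltnS leq_eqVlt => /orP[/eqP jd|/xy//].
rewrite (_ : j = i); last exact: val_inj.
by apply: leq_trans My; exact: leq_bigmax_seq.
Qed.

(** * Infinite triangular systems *)

(** Equation [e] involves finitely many unknowns: [c e], with an invertible coefficient, and
    otherwise only [c t] with [R t e]. It is solved for [c e] by recursion along [R]. *)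
Lemma triangular_solve (k : fieldType) (T : choiceType) (R : T -> T -> Prop)
    (D : pred T) (H : T -> T -> k) (b : T -> k) :
  well_founded R -> (forall e, ~ R e e) ->
  (forall e, D e -> H e e != 0) ->
  (forall t e, D t -> D e -> H t e != 0 -> t = e \/ R t e) ->
  (forall e, D e -> finite_set [set t | D t /\ H t e != 0]) ->
  exists c : T -> k, (forall t, ~~ D t -> c t = 0) /\
    forall e, D e -> \sum_(t \in [set: T]) c t * H t e = b e.
Proof.
move=> Rwf Rirr H0 HR Hfin.
(* [pselect] produces the proof of [R t e] that [rec] demands; triangularity shows that the default
   0 is never taken in this sum. *)
pose step e (rec : forall t, R t e -> k) : k := if D e then
  (b e - \sum_(t \in [set t | D t /\ H t e != 0] `\ e)
    (if pselect (R t e) is left p then rec t p else 0) * H t e) / H e e else 0.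
pose c := Fix Rwf (fun _ => k) step.
have cE e : c e = step e (fun t _ => c t).
  apply: (Fix_eq Rwf (fun _ => k)) => {}e f g fg; congr step.
  by apply: functional_extensionality_dep => t; apply: functional_extensionality_dep => p.
exists c; split=> [t /negPf Dt|e De]; first by rewrite cE /step Dt.
transitivity (\sum_(t \in [set t | D t /\ H t e != 0]) c t * H t e).
  apply/esym/fsbig_widen => // t [_ /= Ht].
  have [Dt|Dt] := boolP (D t); last by rewrite cE /step (negPf Dt) mul0r.
  have [->|Hte] := eqVneq (H t e) 0; first by rewrite mulr0.
  by case: Ht.
rewrite (fsbigD1 e) /=; [|exact: Hfin|by split=> //; exact: H0].
rewrite [in X in X + _]cE /step De divfK ?H0 // -[RHS]addr0 -addrA; congr (_ + _).
rewrite addrC; apply/eqP; rewrite subr_eq0; apply/eqP; apply: eq_fsbigr => t.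
rewrite inE /= => -[[Dt Hte] te]; case: pselect => // nR.
by case: (HR _ _ Dt De Hte).
Qed.

(** * Coefficients and leading exponents in [L] *)

Section QLaurentRing.
Variables (k : fieldType) (n : nat) (q : 'M[k]_n) (hq : mult_antisym q).
Local Notation L := (qlaurent hq).
Local Notation expo := 'rV[int]_n.
Implicit Types (f g h : L) (s t u e : expo).

Let expoB s t i : (s - t) 0 i = (s 0 i : int) - (t 0 i : int).
Proof. by rewrite !mxE. Qed.

Let expoD s t i : (s + t) 0 i = (s 0 i : int) + (t 0 i : int).
Proof. by rewrite !mxE. Qed.

Lemma qtwist_neq0 s t : qtwist q s t != 0.
Proof.
apply/prodf_neq0 => i _; apply/prodf_neq0 => j _; apply: expfz_neq0.
by case: (hq.2 i j).
Qed.

Lemma qcoef0 s : (0 : L) s = 0. Proof. by []. Qed.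

Lemma qcoefB f g s : (f - g) s = f s - g s. Proof. by []. Qed.

Lemma qcoef_sum (I : finType) (F : I -> L) s : (\sum_i F i) s = \sum_i F i s.
Proof.
apply: (big_rec2 (fun (x : L) y => x s = y)) => [|i x y _ <-]; first exact: qcoef0.
exact: coefD.
Qed.

Lemma coefMmono f s t : (f * qmono hq s) t = f (t - s) * qtwist q (t - s) s.
Proof.
rewrite coefM (@fsum_single _ _ _ (t - s)) /=.
  by rewrite subKr eqxx mulr1.
move=> u /negP us; case: eqP => [tu|_]; last by rewrite mulr0 mul0r.
by case: us; rewrite -tu subKr.
Qed.

Lemma coefmonoM f s t : (qmono hq s * f) t = f (t - s) * qtwist q s (t - s).
Proof.
rewrite coefM (@fsum_single _ _ _ s) /= ?eqxx ?mul1r // => u /negPf->.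
by rewrite !mul0r.
Qed.

Definition is_lead f e : Prop := f e != 0 /\ forall t, f t != 0 -> t = e \/ lexlt e t.

Lemma exists_lead f : f != 0 -> exists e, is_lead f e.
Proof.
move=> f0; have [N HN] := coef_bounded f.
have [||e fe He] := @lex_min _ [set s | f s != 0] N; last by exists e.
  apply: contrapT => fN; case/eqP: f0; apply: coefP => s; rewrite qcoef0.
  by apply/eqP/negPn/negP => fs; apply: fN; exists s.
exact: HN.
Qed.

Lemma qlaurent_mulf_eq0 f g : f * g = 0 -> (f == 0) || (g == 0).
Proof.
have [->//|f0] := eqVneq f 0; have [->//|g0] := eqVneq g 0.
have [a [fa Ha]] := exists_lead f0; have [b [gb Hb]] := exists_lead g0.
move=> /(congr1 (fun h : L => h (a + b))); rewrite coefM qcoef0.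
rewrite (@fsum_single _ _ _ a) => [/eqP|t ta].
  by rewrite [a + b]addrC addrK !mulf_eq0 (negPf fa) (negPf gb) (negPf (qtwist_neq0 _ _)).
(* A second nonzero term at [t] would give [a] below [t] and [b] below [a + b - t]; shifting the
   latter by [t - b] puts [t] below [a]. *)
apply/eqP; apply: contraT; rewrite !mulf_eq0 !negb_or => /andP[/andP[/Ha ft /Hb gt] _].
case: ft => [ta'|a_t]; first by rewrite ta' eqxx in ta.
case: gt => [/eqP|]; first by rewrite subr_eq addrC (inj_eq (addrI _)) eq_sym (negPf ta).
move/(lexltD2r (t - b)); rewrite addrC subrK addrA subrK addrK => ta'.
by case: (lexlt_asym a_t ta').
Qed.

Lemma qpower_series_supp f : qpower_series f ->
  forall s, f s != 0 -> forall i, 0 <= s 0 i.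
Proof.
move=> Hf s fs i; rewrite leNgt; apply/negP => si.
by case/eqP: fs; apply: Hf; exists i.
Qed.

(** * Division of power series *)

Lemma fsum_exchange (I : finType) (F : I -> expo -> k) K :
  (forall i t, F i t != 0 -> box K t) ->
  \sum_i \sum_(t \in [set: expo]) F i t = \sum_(t \in [set: expo]) \sum_i F i t.
Proof.
move=> FK; rewrite [RHS](@fsum_box _ _ _ K); last first.
  move=> t Ht; apply: contrapT => tK; case/eqP: Ht; rewrite big1 // => i _.
  by apply/eqP; apply: contraT => /FK.
rewrite (fsbig_finite _ _ (finite_box _ K)) exchange_big /=.
by apply: eq_bigr => i _; rewrite (@fsum_box _ _ _ K) ?fsbig_finite //; [exact: finite_box|exact: FK].
Qed.

(** Every exponent [t] above some [e i] selects one such [i], and then [f i * x^(t - e i)] has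
    leading exponent [t]. Matching [h] on all these exponents by a combination of these series with
    coefficients [c t] is therefore a triangular system. *)
Lemma qpower_division (r : nat) (f : 'I_r -> L) (e : 'I_r -> expo) h :
  (forall i, qpower_series (f i)) -> (forall i, is_lead (f i) (e i)) ->
  exists g : 'I_r -> L, (forall i, qpower_series (g i)) /\
    forall t, (exists i, forall j, e i 0 j <= t 0 j) ->
      (h - \sum_i f i * g i) t = 0.
Proof.
move=> fR lead_f.
have e0 i j : 0 <= e i 0 j by apply: qpower_series_supp (lead_f i).1 _.
pose below i t := [forall j, e i 0 j <= t 0 j].
pose sel t := [pick i | below i t].
pose D t := [exists i, below i t].
have selD t : D t -> exists2 i, sel t = Some i & below i t.
  by case/existsP => i it; rewrite /sel; case: pickP => [j|/(_ i)]; [exists j|rewrite it].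
have sel_below i t : sel t = Some i -> below i t.
  by rewrite /sel; case: pickP => // j jt [<-].
(* The coefficient at [u] of [f i * x^(t - e i)], where [i = sel t]. *)
pose H t u := if sel t is Some i then
  f i (u - (t - e i)) * qtwist q (u - (t - e i)) (t - e i) else 0.
have Hsupp t u : H t u != 0 -> exists2 i, sel t = Some i & f i (u - (t - e i)) != 0.
  by rewrite /H; case: (sel t) => [i|]; rewrite ?eqxx // mulf_eq0 negb_or => /andP[]; exists i.
pose M := (\max_i expo_size (e i))%N.
(* The support of [f i] is nonnegative, so only exponents [t] with [0 <= t <= u + e i] contribute to
   the coefficient at [u]. *)
have Hbox t u : H t u != 0 -> box (M + expo_size u) t.
  case/Hsupp => i /sel_below/forallP it /(qpower_series_supp (fR i)) Hu j.
  have := it j; have := Hu j; have := e0 i j; rewrite !expoB.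
  have := le_expo_size u j; have := le_expo_size (e i) j.
  have : (expo_size (e i) <= M)%N by exact: leq_bigmax.
  lia.
have [||||c [c0 Hc]] := @triangular_solve k _ _ D H h (@lex_wf n).
- by move=> t [_ /lexlt_irr].
- move=> t /selD[i si _]; rewrite /H si opprB addrC subrK mulf_neq0 ?qtwist_neq0 //.
  exact: (lead_f i).1.
- move=> t u Dt Du /Hsupp[i si /(lead_f i).2[/eqP|]].
    by rewrite subr_eq addrC subrK => /eqP->; left.
  move/(lexltD2r (t - e i)); rewrite subrK addrC subrK => tu; right; split=> //.
  by apply/forallP => j; have /forallP/(_ j) := sel_below _ _ si; apply: le_trans (e0 i j).
- move=> t _; apply: sub_finite_set (finite_box _ (M + expo_size t)%N).
  by move=> u [_ /Hbox].
(* The quotient of index [i] collects the unknowns whose exponent selects [i], shifted down by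
   [e i]. *)
pose gc i s : k := if sel (s + e i) == Some i then c (s + e i) else 0.
have gc_supp i s : gc i s != 0 -> forall j, 0 <= s 0 j.
  rewrite /gc; have [si _ j|] := eqVneq (sel (s + e i)) (Some i); last by rewrite eqxx.
  by have /forallP/(_ j) := sel_below _ _ si; rewrite expoD; lia.
have gcB i : gc i \in @bounded_below_pred k n.
  by apply/bounded_belowP; exists 0%N => s /gc_supp si j; rewrite oppr0.
pose g i : L := QLaurent hq (gcB i).
exists g; split=> [i s [j sj]|t [i it]].
  by apply/eqP; apply: contraTT sj => /gc_supp/(_ j); rewrite -leNgt.
have Dt : D t by apply/existsP; exists i; apply/forallP.
apply/eqP; rewrite qcoefB subr_eq0 qcoef_sum -(Hc t Dt); apply/eqP/esym.
have termE l : (f l * g l) t =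
    \sum_(u \in [set: expo]) (if sel u == Some l then c u * H u t else 0).
  rewrite coefM (reindex_fsbigT (fun u => t - (u - e l))); last first.
    by exists (fun u => t - u + e l) => u; rewrite ?addrK ?subKr ?subrK.
  apply: eq_fsbigr => u _ /=; rewrite subKr /gc subrK /H.
  by case: eqP => [->|_]; rewrite ?mulr0 ?mul0r // mulrCA mulrA.
under eq_bigr do rewrite termE.
rewrite (@fsum_exchange _ _ (M + expo_size t)); last first.
  move=> l u; case: ifP => [_|]; rewrite ?eqxx // mulf_eq0 negb_or.
  by case/andP => _ /Hbox.
apply: eq_fsbigr => u _; case su: (sel u) => [l|].
  rewrite (bigD1 l) //= eqxx big1 ?addr0 // => j /negPf jl.
  by case: eqP => // -[lj]; rewrite lj eqxx in jl.
rewrite big1 // c0 ?mul0r //; apply/negP => /selD[j].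
by rewrite su.
Qed.

(** * Ascending chains of right ideals *)

Lemma qlaurent_to_qpower_series f : exists s, qpower_series (f * qmono hq s).
Proof.
have [N HN] := coef_bounded f; exists (const_mx N%:Z) => t [i ti].
rewrite coefMmono; apply/eqP; apply: contraT; rewrite mulf_eq0 negb_or.
by case/andP => /HN/(_ i); rewrite expoB mxE; lia.
Qed.

Lemma qmono_unit s : exists g, qmono hq s * g = 1.
Proof.
exists ((qtwist q s (- s))^-1 *: qmono hq (- s)).
by rewrite -qscaleAr qmonoM subrr scalerA mulVf ?qtwist_neq0 // scale1r.
Qed.

Definition right_ideal (A : nzRingType) (J : set A) : Prop :=
  [/\ J 0, forall x y, J x -> J y -> J (x + y) & forall x a, J x -> J (x * a)].

Lemma qlaurent_right_noetherian (J : nat -> set L) :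
  (forall m, right_ideal (J m)) -> (forall m, J m `<=` J m.+1) ->
  exists N, forall m, J m `<=` J N.
Proof.
move=> Jid Jsub.
have Jmono m p : (m <= p)%N -> J m `<=` J p.
  by move=> /subnK <-; elim: (p - m)%N => // d IHd; apply: subset_trans (Jsub _).
pose E : set L := [set f | f != 0 /\ qpower_series f /\ exists m, J m f].
have exld f : exists e, f != 0 -> is_lead f e.
  by have [_|/exists_lead[e]] := eqVneq f 0; [exists 0|exists e].
have [ld Hld] := choice exld.
(* Series in [E] have nonnegative leading exponents, so [absz] loses nothing on them. *)
have [F [FE HF]] := dickson (fun f i => absz (ld f 0 i)) E.
have [N HN] : exists N, forall f, f \in F -> J N f.
  have {HF} : forall f, f \in F -> exists m, J m f by move=> f /FE[_ [_]].
  elim: F {FE} => [_|f F IHF HF]; first by exists 0%N.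
  have [N HN] := IHF (fun g gF => HF g (mem_behead (s := f :: F) gF)).
  have [m Hm] := HF f (mem_head _ _); exists (maxn m N) => g.
  rewrite inE => /orP[/eqP->|/HN]; [move: Hm|]; apply: Jmono; lia.
exists N => m f Jf; have [JN0 JND JNM] := Jid N.
pose F' i := tnth (in_tuple F) i.
have F'F i : F' i \in F by exact: mem_tnth.
have [s fs] := qlaurent_to_qpower_series f.
have [||g [gR Hg]] := @qpower_division _ F' (fun i => ld (F' i)) (f * qmono hq s).
- by move=> i; case: (FE _ (F'F i)) => _ [].
- by move=> i; apply: Hld; case: (FE _ (F'F i)).
have sumN : J N (\sum_i F' i * g i).
  by elim/big_rec: _ => // i x _ Jx; apply: JND Jx; apply/JNM/HN.
have sE : f * qmono hq s = \sum_i F' i * g i.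
  (* A nonzero remainder would lie in [E], so its leading exponent would be above that of a member
     of [F]; the division makes the coefficient there zero. *)
  apply/eqP; rewrite -subr_eq0; apply: contraT => r0.
  set r := (X in X != 0) in r0.
  have Er : E r.
    split=> //; split.
      have [_ RB RM] := qpower_series_closed hq; apply: (RB) => //.
      elim/big_rec: _ => [t _ //|i x _ Rx].
      rewrite -[x]opprK; apply: (RB); first by apply: (RM) => //; case: (FE _ (F'F i)) => _ [].
      by rewrite -[- x]sub0r; apply: (RB) => // t _.
    exists (maxn m N); have [_ JD JM] := Jid (maxn m N); apply: (JD).
      by apply: (JM); apply: Jmono Jf; rewrite leq_maxl.
    by rewrite -mulrN1; apply: (JM); apply: Jmono sumN; rewrite leq_maxr.
  have [rl _] := Hld _ r0; have [p pF pr] := HF _ Er.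
  have nn f' : E f' -> forall i, 0 <= ld f' 0 i.
    by move=> [f0 [fR _]]; apply: qpower_series_supp fR _ (Hld _ f0).1.
  case/eqP: rl; apply: Hg; move: (pF); rewrite -index_mem => ip.
  exists (Ordinal ip) => j; rewrite /F' (tnth_nth 0) /= nth_index //.
  by have := pr j; have := nn _ Er j; have := nn _ (FE _ pF) j; lia.
have [v sv] := qmono_unit s.
by rewrite -[f]mulr1 -sv mulrA sE; apply: JNM.
Qed.

(** * The center and the extension of its ideals to [L] *)

(** By [qmonoM], this says that x^s commutes with every monomial. *)
Definition qcentral s : bool := `[< forall t, qtwist q s t = qtwist q t s >].

Lemma qcentralB s t : qcentral s -> qcentral t -> qcentral (s - t).
Proof.
move=> /asboolP Hs /asboolP Ht; apply/asboolP => u.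
apply: (mulIf (qtwist_neq0 t u)); rewrite -(qtwistDl hq) subrK Hs [in RHS]Ht.
by rewrite -(qtwistDr hq) subrK.
Qed.

Lemma qcentral_addr s t : qcentral t -> qcentral (s - t) = qcentral s.
Proof.
move=> Ht; apply/idP/idP => Hs; last exact: qcentralB.
have H0 : qcentral 0 by apply/asboolP => u; rewrite qtwist0l qtwist0r.
by rewrite -[s](subrK t) -[t in _ + t]opprK; apply: qcentralB => //; rewrite -sub0r; exact: qcentralB.
Qed.

(** Comparing the coefficients at [s + t] of [f * x^t] and [x^t * f] and cancelling [f s] gives one
    direction; for the other, the two convolutions agree term by term after the reindexing
    [t -> s - t]. *)
Lemma ring_center_supp f :
  f \in @ring_center L <-> forall s, f s != 0 -> qcentral s.
Proof.
split=> [/asboolP Hf s fs|Hf].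
  apply/asboolP => t; have := congr1 (fun h : L => h (s + t)) (Hf (qmono hq t)).
  by rewrite coefMmono coefmonoM addrK => /(mulfI fs).
apply/asboolP => g; apply: coefP => s; rewrite !coefM.
rewrite [RHS](reindex_fsbigT (fun t => s - t)); last by exists (fun t => s - t) => t; rewrite subKr.
apply: eq_fsbigr => t _; rewrite subKr [g _ * _]mulrC.
have [->|/Hf/asboolP->//] := eqVneq (f t) 0; by rewrite !mul0r.
Qed.

Lemma central_part_bounded f :
  (fun s => if qcentral s then f s else 0) \in @bounded_below_pred k n.
Proof.
have [N HN] := coef_bounded f; apply/bounded_belowP; exists N => s.
by case: ifP => _; [exact: HN|rewrite eqxx].
Qed.

Definition central_part f : L := QLaurent hq (central_part_bounded f).

Lemma central_part_center f : central_part f \in @ring_center L.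
Proof. by apply/ring_center_supp => s /=; case: ifP; rewrite ?eqxx. Qed.

Lemma central_partD f g : central_part (f + g) = central_part f + central_part g.
Proof. by apply: coefP => s; rewrite coefD /=; case: ifP; rewrite ?addr0. Qed.

Lemma central_part_id f : f \in @ring_center L -> central_part f = f.
Proof.
move=> /ring_center_supp Hf; apply: coefP => s /=; case: ifP => // /negbT.
by move/(contraNN (Hf s))/negPn/eqP.
Qed.

(** For [t] in the support of [f], the exponents [s] and [s - t] are central together, so the
    restriction keeps or kills all the terms at [s] at once. *)
Lemma central_partM f g : f \in @ring_center L ->
  central_part (f * g) = f * central_part g.
Proof.
move=> /ring_center_supp Hf; apply: coefP => s; rewrite [LHS]/= !coefM.
have H t : f t != 0 -> qcentral (s - t) = qcentral s by move/Hf/qcentral_addr.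
case: ifP => cs.
  apply: eq_fsbigr => t _ /=; have [->|/H->] := eqVneq (f t) 0; first by rewrite !mul0r.
  by rewrite cs.
rewrite fsbig1 // => t _ /=; have [->|/H->] := eqVneq (f t) 0; first by rewrite !mul0r.
by rewrite cs mulr0 mul0r.
Qed.

(* The largest right ideal of L that [central_part] maps into [I]. *)
Definition central_extension (I : set (center_ring L)) : set L :=
  [set f | forall g, exists2 c, I c & central_part (f * g) = val c].

Lemma central_extension_ideal I : is_ideal I -> right_ideal (central_extension I).
Proof.
move=> [I0 ID IM]; split=> [g|x y Hx Hy g|x a Hx g].
- by exists 0 => //; rewrite mul0r; apply: coefP => s /=; case: ifP.
- have [c Ic xc] := Hx g; have [d Id yd] := Hy g.
  by exists (c + d); [exact: ID|rewrite mulrDl central_partD xc yd].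
- by have [c Ic xc] := Hx (a * g); exists c => //; rewrite -mulrA.
Qed.

(** The choice [g = 1] recovers [c]; conversely, linearity over the center turns
    [central_part (c * g)] into a multiple of [c]. Hence [I] can be read off from its extension, and
    stabilization passes from the extensions to the ideals. *)
Lemma central_extension_val I c :
  is_ideal I -> central_extension I (val c) <-> I c.
Proof.
move=> [I0 ID IM]; split=> [/(_ 1)[d Id]|Ic g].
  by rewrite mulr1 central_part_id ?(valP c) // => /val_inj ->.
exists (CenterRing (central_part_center g) * c); first exact: IM.
rewrite central_partM ?(valP c) //.
by have /asboolP := valP c; apply.
Qed.

End QLaurentRing.

Theorem corollary3p12 (k : fieldType) (n : nat) (hn : (1 <= n)%N)
    (q : 'M[k]_n) (hq : mult_antisym q) :
  noetherian_domain (center_ring (qlaurent hq)).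
Proof.
split=> [x y /(congr1 val)/qlaurent_mulf_eq0 //|I Iid Isub].
have [||N HN] := @qlaurent_right_noetherian _ _ _ hq (fun m => central_extension (I m)).
- by move=> m; apply: central_extension_ideal; apply: Iid.
- by move=> m f Hf g; have [c /Isub] := Hf g; exists c.
exists N => m Nm; apply/seteqP; split=> [c /(central_extension_val _ (Iid m))/HN|].
  by move/(central_extension_val _ (Iid N)).
move: Nm => /subnK <-; elim: (m - N)%N => // d IHd.
exact: subset_trans (Isub _).
Qed.
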